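(* Let $h>0$, $\alpha,\gamma>0$, $\kappa\in\mathbb{R}$, and let $\beta,V$ be smooth real functions of $\phi$ near $0$ with $\beta(0)\neq0$, $V'(0)=0$ and $V''(0)<0$. Consider the discrete controlled system $$\frac{\partial L^d(q_k,q_{k+1})}{\partial\phi_k}+\frac{\partial L^d(q_{k-1},q_k)}{\partial\phi_k}=0,\qquad \frac{\partial L^d(q_k,q_{k+1})}{\partial s_k}+\frac{\partial L^d(q_{k-1},q_k)}{\partial s_k}=-u_k,$$ with control input $$u_k=-\frac{\gamma\kappa\,\beta(\phi_{k+1/2})\,\Delta\phi_k-\gamma\kappa\,\beta(\phi_{k-1/2})\,\Delta\phi_{k-1}}{h}.$$ If $$\kappa>\frac{\alpha\gamma-\beta^2(0)}{\beta^2(0)\,\gamma},$$ then the relative equilibria $\phi_k=0$, $\Delta s_k=\mathrm{const}$ of this system are spectrally stable.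
   Context: Configuration variables are $q=(\phi,s)$, with shape variable $\phi$ (a local coordinate near $0$) and group variable $s\in\mathbb{R}$. For a sequence $q_k=(\phi_k,s_k)$ write $q_{k+1/2}=(q_k+q_{k+1})/2$ (componentwise) and $\Delta q_k=q_{k+1}-q_k$. The discrete Lagrangian is $$L^d(q_k,q_{k+1})=\frac h2\Big[\alpha\Big(\frac{\Delta\phi_k}{h}\Big)^2+2\beta(\phi_{k+1/2})\frac{\Delta\phi_k}{h}\frac{\Delta s_k}{h}+\gamma\Big(\frac{\Delta s_k}{h}\Big)^2\Big]-hV(\phi_{k+1/2}),$$ with $\alpha,\gamma$ constants and the potential depending only on $\phi$. With the given control $u_k$, the second equation is equivalent to conservation of the discrete controlled momentum $$p_k=\frac{(1+\gamma\kappa)\beta(\phi_{k+1/2})\Delta\phi_k+\gamma\Delta s_k}{h}.$$ The reduced dynamics on the momentum level $p_k=p$ is the second-order difference equation in $\phi$ obtained by solving $p_k=p_{k-1}=p$ for $\Delta s_k,\Delta s_{k-1}$ and substituting into the first equation. Each relative equilibrium $\phi_k=0$, $\Delta s_k=\mathrm{const}$ corresponds to the equilibrium $\phi_k=0$ of the reduced dynamics on its momentum level $p$. Spectral stability of the relative equilibrium means that the linear map $(\phi_{k-1},\phi_k)\mapsto(\phi_k,\phi_{k+1})$ defined by the linearization at $\phi=0$ of the reduced dynamics has its spectrum contained in the unit circle of $\mathbb{C}$. *)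

(* Defs.v *)
From mathcomp Require Import all_boot all_order all_algebra.
From mathcomp Require Import all_classical all_reals all_analysis.
From mathcomp Require Import complex ring lra.

Set Implicit Arguments.
Unset Strict Implicit.
Unset Printing Implicit Defensive.

Import Order.TTheory GRing.Theory Num.Theory.
Import numFieldNormedType.Exports.

Local Open Scope classical_set_scope.
Local Open Scope ring_scope.

(* A configuration q = (phi, s) is a pair q : R * R.  The functions beta and V
   are total, but only their germs at 0 matter in what follows. *)

Definition smooth_near0 (R : realType) (f : R -> R) : Prop :=
  \forall x \near (0 : R), forall n : nat, derivable (derive1n n f) x 1.

Definition discrete_lagrangian (R : realType) (h alpha gamma : R)
    (beta V : R -> R) (q0 q1 : R * R) : R :=
  let mid := (q0.1 + q1.1) / 2 in
  let dphi := q1.1 - q0.1 in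
  let ds := q1.2 - q0.2 in
  h / 2 * (alpha * (dphi / h) ^+ 2
           + 2 * beta mid * (dphi / h) * (ds / h)
           + gamma * (ds / h) ^+ 2)
  - h * V mid.

(* In the next two definitions q, q0, q1 stand for q_(k-1), q_k, q_(k+1), and
   the derivative is taken in one component of the shared point q_k. *)
Definition phi_equation_lhs (R : realType) (h alpha gamma : R)
    (beta V : R -> R) (q q0 q1 : R * R) : R :=
  let L := discrete_lagrangian h alpha gamma beta V in
  derive1 (fun x : R => L (x, q0.2) q1) q0.1
  + derive1 (fun x : R => L q (x, q0.2)) q0.1.

Definition s_equation_lhs (R : realType) (h alpha gamma : R)
    (beta V : R -> R) (q q0 q1 : R * R) : R :=
  let L := discrete_lagrangian h alpha gamma beta V in
  derive1 (fun y : R => L (q0.1, y) q1) q0.2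
  + derive1 (fun y : R => L q (q0.1, y)) q0.2.

Definition control (R : realType) (h gamma kappa : R) (beta : R -> R)
    (q q0 q1 : R * R) : R :=
  - ((gamma * kappa * beta ((q0.1 + q1.1) / 2) * (q1.1 - q0.1)
      - gamma * kappa * beta ((q.1 + q0.1) / 2) * (q0.1 - q.1)) / h).

Definition controlled_solution (R : realType) (h alpha gamma kappa : R)
    (beta V : R -> R) (q : int -> R * R) : Prop :=
  forall k : int,
    phi_equation_lhs h alpha gamma beta V (q (k - 1)) (q k) (q (k + 1)) = 0
    /\ s_equation_lhs h alpha gamma beta V (q (k - 1)) (q k) (q (k + 1))
       = - control h gamma kappa beta (q (k - 1)) (q k) (q (k + 1)).

Definition controlled_momentum (R : realType) (h gamma kappa : R)
    (beta : R -> R) (q0 q1 : R * R) : R :=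
  ((1 + gamma * kappa) * beta ((q0.1 + q1.1) / 2) * (q1.1 - q0.1)
   + gamma * (q1.2 - q0.2)) / h.

(* The increment of s obtained by solving controlled_momentum = p. *)
Definition momentum_increment (R : realType) (h gamma kappa : R)
    (beta : R -> R) (p phi0 phi1 : R) : R :=
  (h * p - (1 + gamma * kappa) * beta ((phi0 + phi1) / 2) * (phi1 - phi0))
  / gamma.

(* The reduced dynamics on the level p is the second-order difference equation
   reduced_equation_lhs ... p (phi_(k-1), phi_k, phi_(k+1)) = 0.  The base
   value s_k = 0 is immaterial: see reduced_equationP. *)
Definition reduced_equation_lhs (R : realType) (h alpha gamma kappa : R)
    (beta V : R -> R) (p : R) (w : R^o * R^o * R^o) : R^o :=
  let ds := momentum_increment h gamma kappa beta p in
  let: (phi, phi0, phi1) := w in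
  phi_equation_lhs h alpha gamma beta V
    (phi, - ds phi phi0) (phi0, 0) (phi1, ds phi0 phi1).

Definition row2 (R : realType) (x y : R) : 'rV[R]_2 :=
  \row_(j < 2) [:: x; y]`_j.

(* M is the matrix, acting on row vectors, of the map (x, y) |-> (y, z) defined
   by the linearization 'd F 0 (x, y, z) = 0 of the difference equation F = 0.
   Such an M exists, and is then unique, iff this equation can be solved for z,
   i.e. iff 'd F 0 (0, 0, 1) != 0. *)
Definition linearized_map (R : realType) (F : R^o * R^o * R^o -> R^o)
    (M : 'M[R]_2) : Prop :=
  differentiable F 0 /\
  forall x y z : R, 'd F 0 (x, y, z) = 0 <-> row2 x y *m M = row2 y z.

Definition spectrum (R : realType) (n : nat) (M : 'M[R]_n) : set R[i] :=
  [set z | eigenvalue (map_mx (real_complex R) M) z].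

Definition unit_circle (R : realType) : set R[i] := [set z | `|z| = 1].

Definition spectrally_stable_at0 (R : realType)
    (F : R^o * R^o * R^o -> R^o) : Prop :=
  F 0 = 0 /\
  exists2 M : 'M[R]_2, linearized_map F M & spectrum M `<=` @unit_circle R.

Definition relative_equilibrium (R : realType) (h alpha gamma kappa : R)
    (beta V : R -> R) (q : int -> R * R) : Prop :=
  [/\ controlled_solution h alpha gamma kappa beta V q,
      forall k, (q k).1 = 0
    & exists c : R, forall k, (q (k + 1)).2 - (q k).2 = c].

Definition spectrally_stable (R : realType) (h alpha gamma kappa : R)
    (beta V : R -> R) (q : int -> R * R) : Prop :=
  exists2 p : R,
    (forall k, controlled_momentum h gamma kappa beta (q k) (q (k + 1)) = p)
  & spectrally_stable_at0 (reduced_equation_lhs h alpha gamma kappa beta V p).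

Lemma momentum_incrementP (R : realType) (h gamma kappa : R) (beta : R -> R)
    (p : R) (q0 q1 : R * R) : h != 0 -> gamma != 0 ->
  controlled_momentum h gamma kappa beta q0 q1 = p <->
  q1.2 - q0.2 = momentum_increment h gamma kappa beta p q0.1 q1.1.
Proof.
move=> h0 g0; rewrite /controlled_momentum /momentum_increment.
split=> [<-|->]; by field; rewrite ?h0 ?g0.
Qed.

Lemma reduced_equationP (R : realType) (h alpha gamma kappa : R)
    (beta V : R -> R) (p : R) (q q0 q1 : R * R) : h != 0 -> gamma != 0 ->
  controlled_momentum h gamma kappa beta q q0 = p ->
  controlled_momentum h gamma kappa beta q0 q1 = p ->
  phi_equation_lhs h alpha gamma beta V q q0 q1 =
  reduced_equation_lhs h alpha gamma kappa beta V p (q.1, q0.1, q1.1).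
Proof.
move=> h0 g0 /(momentum_incrementP _ _ _ _ _ h0 g0) ds.
move=> /(momentum_incrementP _ _ _ _ _ h0 g0) ds1.
have Lds (a b c d a' c' : R) : c - a = c' - a' ->
    discrete_lagrangian h alpha gamma beta V (b, a) (d, c) =
    discrete_lagrangian h alpha gamma beta V (b, a') (d, c').
  by rewrite /discrete_lagrangian /= => ->.
case: q q0 q1 ds ds1 => [x s] [x0 s0] [x1 s1] /= ds ds1.
rewrite /reduced_equation_lhs /phi_equation_lhs -ds -ds1 /=.
congr (_ + _).
- suff -> : (fun z : R => discrete_lagrangian h alpha gamma beta V
      (z, s0) (x1, s1)) = (fun z : R => discrete_lagrangian h alpha gamma beta V
      (z, 0) (x1, s1 - s0)) by [].
  by apply/funext => z; apply: Lds; rewrite subr0.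
- suff -> : (fun z : R => discrete_lagrangian h alpha gamma beta V
      (x, s) (z, s0)) = (fun z : R => discrete_lagrangian h alpha gamma beta V
      (x, - (s0 - s)) (z, 0)) by [].
  by apply/funext => z; apply: Lds; rewrite sub0r opprK.
Qed.

(* With the given control, the second equation says that the controlled
   momentum is conserved. *)
Lemma s_equationP (R : realType) (h alpha gamma kappa : R)
    (beta V : R -> R) (q q0 q1 : R * R) : h != 0 ->
  s_equation_lhs h alpha gamma beta V q q0 q1
    = - control h gamma kappa beta q q0 q1 <->
  controlled_momentum h gamma kappa beta q0 q1
    = controlled_momentum h gamma kappa beta q q0.
Proof.
move=> h0.
have dquad (a b c y : R) :
    derive1 (fun z : R => a + b * z + c * (z * z)) y = b + 2 * c * y.
  by rewrite derive1E derive_val /GRing.scale /=; ring.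
rewrite /s_equation_lhs /discrete_lagrangian /control /controlled_momentum /=.
set b1 := beta ((q0.1 + q1.1) / 2); set b0 := beta ((q.1 + q0.1) / 2).
set v1 := V _; set v0 := V _.
under [X in derive1 X _ + _]eq_fun => y.
  rewrite (_ : _ - _ = (h / 2 * (alpha * ((q1.1 - q0.1) / h) ^+ 2
      + 2 * b1 * ((q1.1 - q0.1) / h) * (q1.2 / h) + gamma * (q1.2 / h) ^+ 2)
      - h * v1) + (- (b1 * (q1.1 - q0.1) + gamma * q1.2) / h) * y
      + (gamma / (2 * h)) * (y * y)); last by field.
  over.
under [X in _ + derive1 X _]eq_fun => y.
  rewrite (_ : _ - _ = (h / 2 * (alpha * ((q0.1 - q.1) / h) ^+ 2
      - 2 * b0 * ((q0.1 - q.1) / h) * (q.2 / h) + gamma * (q.2 / h) ^+ 2)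
      - h * v0) + ((b0 * (q0.1 - q.1) - gamma * q.2) / h) * y
      + (gamma / (2 * h)) * (y * y)); last by field.
  over.
rewrite !dquad.
split=> [e|e].
- apply/eqP; rewrite -subr_eq0; apply/eqP; move/eqP: e; rewrite -subr_eq0 => /eqP e.
  by apply: oppr_inj; rewrite oppr0 -[RHS]e; field.
- apply/eqP; rewrite -subr_eq0; apply/eqP; move/eqP: e; rewrite -subr_eq0 => /eqP e.
  by apply: oppr_inj; rewrite oppr0 -[RHS]e; field.
Qed.

(* Main.v *)
Require Import Defs.
From mathcomp Require Import all_boot all_order all_algebra.
From mathcomp Require Import all_classical all_reals all_analysis.
From mathcomp Require Import complex ring lra.

Import Order.TTheory GRing.Theory Num.Theory.
Import numFieldNormedType.Exports.

Local Open Scope ring_scope.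

(* Eliminating the group variable, the reduced dynamics on a momentum level
   linearizes at phi = 0 to a (x - 2 y + z) + c (x + 2 y + z) = 0, where
   a = ((1 + gamma kappa) beta(0)^2 / gamma - alpha) / h and c = - h V''(0) / 4.
   The bound on kappa says exactly that a > 0, and c > 0 since V''(0) < 0.
   Hence z = t y - x with t = 2 (a - c) / (a + c) in ]-2, 2[, and the roots of
   X^2 - t X + 1 are conjugate and of product 1. *)

(** * Differentials in normed spaces *)

(** Equality near [x] includes the point [x], so the little-o expansion of [f] is one for [g], and
    uniqueness of the differential concludes. It serves where an explicit formula is available only
    near 0. *)
Lemma near_eq_is_diff (K : numFieldType) (U W : normedModType K)
    (f g df : U -> W) (x : U) :
  (\forall y \near x, f y = g y) -> is_diff x f df -> is_diff x g df.
Proof.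
move=> fg [fx <-].
have fg0 : \forall y \near (0 : U), f (y + x) = g (y + x).
  by rewrite (near_shift x); near do rewrite /= sub0r subrK.
have [dc gE] : continuous ('d f x) /\
    g \o shift x = cst (g x) + 'd f x +o_ 0 id.
  split; first exact: diff_continuous.
  apply/eqaddoP => e e0; have /eqaddoP/(_ _ e0) := diff_locally fx.
  by apply: filterS2 fg0 => y; rewrite !fctE /= => -> ; rewrite (nbhs_singleton fg).
apply: DiffDef; last exact: diff_unique.
by apply/diff_locallyP; rewrite (diff_unique dc gE).
Unshelve. all: by end_near. Qed.

Lemma is_diff_fst (K : numFieldType) (U V : normedModType K) (x : U * V) :
  is_diff x fst fst.
Proof.
by apply: DiffDef; [apply: linear_differentiable|apply: diff_lin] => y; apply: cvg_fst.
Qed.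

Lemma is_diff_snd (K : numFieldType) (U V : normedModType K) (x : U * V) :
  is_diff x snd snd.
Proof.
by apply: DiffDef; [apply: linear_differentiable|apply: diff_lin] => y; apply: cvg_snd.
Qed.

(** * Slopes of the discrete Lagrangian and their differentials *)

Section slopes.
Context {R : realType}.
Variables (h alpha gamma : R) (beta V : R -> R).

(* Both partial derivatives of the discrete Lagrangian in the shape variable:
   [sgn] is [-1] for the left endpoint of the edge and [1] for the right one. *)
Definition lagrangian_slope (sgn x0 x1 ds : R) : R :=
  let mid := (x0 + x1) / 2 in
  h^-1 * (sgn * (alpha * (x1 - x0) + beta mid * ds)
             + 2^-1 * (derive1 beta mid * (x1 - x0) * ds))
  - h / 2 * derive1 V mid.

Lemma is_derive_comp_mid (f : R -> R) (a x : R) :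
  derivable f ((x + a) / 2) 1 ->
  is_derive x 1 (fun y => f ((y + a) / 2)) (derive1 f ((x + a) / 2) / 2).
Proof.
move=> df; apply: is_derive1_comp.
  by rewrite derive1E; exact: derivableP.
by apply: is_derive_eq; rewrite /GRing.scale /=; ring.
Qed.

Lemma derive1_lagrangian_left (x0 s0 x1 s1 : R) : h != 0 ->
  derivable beta ((x0 + x1) / 2) 1 -> derivable V ((x0 + x1) / 2) 1 ->
  derive1 (fun x => discrete_lagrangian h alpha gamma beta V (x, s0) (x1, s1)) x0
  = lagrangian_slope (-1) x0 x1 (s1 - s0).
Proof.
(* The chain-rule facts stay in the context, where [derive_val] picks them up as instances. *)
move=> h0 /is_derive_comp_mid db /is_derive_comp_mid dV.
rewrite derive1E /discrete_lagrangian/= derive_val /GRing.scale /=.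
by rewrite /lagrangian_slope/=; field.
Qed.

Lemma derive1_lagrangian_right (x0 s0 x1 s1 : R) : h != 0 ->
  derivable beta ((x0 + x1) / 2) 1 -> derivable V ((x0 + x1) / 2) 1 ->
  derive1 (fun x => discrete_lagrangian h alpha gamma beta V (x0, s0) (x, s1)) x1
  = lagrangian_slope 1 x0 x1 (s1 - s0).
Proof.
move=> h0.
have flip (f : R -> R) : derivable f ((x0 + x1) / 2) 1 ->
    is_derive x1 1 (fun y => f ((x0 + y) / 2)) (derive1 f ((x0 + x1) / 2) / 2).
  rewrite addrC => /is_derive_comp_mid.
  by congr is_derive; apply/funext => y; rewrite addrC.
move=> /flip db /flip dV.
rewrite derive1E /discrete_lagrangian/= derive_val /GRing.scale /=.
by rewrite /lagrangian_slope/=; field.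
Qed.

Lemma phi_equation_slopes (q q0 q1 : R * R) : h != 0 ->
  derivable beta ((q.1 + q0.1) / 2) 1 -> derivable V ((q.1 + q0.1) / 2) 1 ->
  derivable beta ((q0.1 + q1.1) / 2) 1 -> derivable V ((q0.1 + q1.1) / 2) 1 ->
  phi_equation_lhs h alpha gamma beta V q q0 q1 =
  lagrangian_slope (-1) q0.1 q1.1 (q1.2 - q0.2)
  + lagrangian_slope 1 q.1 q0.1 (q0.2 - q.2).
Proof.
case: q q0 q1 => [x s] [x0 s0] [x1 s1] /= h0 b v b1 v1.
by rewrite -(derive1_lagrangian_left _ s0 _ s1 h0 b1 v1)
  -(derive1_lagrangian_right _ s _ s0 h0 b v).
Qed.

(** The increment and the midpoint of the edge vanish at 0, so few terms of the product rule
    survive. The factor of [derive1 beta 0] is a multiple of [- 2 * x0] for [sgn = -1] and of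
    [2 * x1] for [sgn = 1]: opposite on two edges that share a point. *)
Lemma is_diff_lagrangian_slope (U : normedModType R) (kappa p sgn : R)
    (x0 x1 : U -> R) :
  is_diff 0 x0 x0 -> is_diff 0 x1 x1 -> x0 0 = 0 -> x1 0 = 0 ->
  derivable beta 0 1 -> derivable (derive1 beta) 0 1 ->
  derivable (derive1 V) 0 1 ->
  is_diff 0 (fun u => lagrangian_slope sgn (x0 u) (x1 u)
      (momentum_increment h gamma kappa beta p (x0 u) (x1 u)))
    (fun u => h^-1 *
        (sgn * (alpha - (1 + gamma * kappa) * beta 0 ^+ 2 / gamma) * (x1 u - x0 u)
         + derive1 beta 0 * (h * p / gamma) / 2
           * (sgn * (x0 u + x1 u) + (x1 u - x0 u)))
      - h / 2 * (derive1n 2 V 0 * (2^-1 * (x0 u + x1 u)))).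
Proof.
move=> dx0 dx1 x00 x10 db db' dV'.
pose d := x1 - x0; pose m := 2^-1 *: (x0 + x1).
have dd : is_diff 0 d d by apply: is_diffB.
have dm : is_diff 0 m m by apply: is_diffZ; apply: is_diffD.
have m0 : m 0 = 0 by rewrite /m /= !fctE x00 x10 addr0 scaler0.
have d0 : d 0 = 0 by rewrite /d /= !fctE x00 x10 subr0.
have comp_m (f : R -> R) : derivable f 0 1 ->
    is_diff 0 (f \o m) (derive1 f 0 *: m).
  move=> df; apply: (@is_diff_eq _ _ _ _ (( *:%R^~ (derive1 f 0)) \o m)).
    apply: is_diff_comp; rewrite m0 -deriv1E//.
    by apply: differentiableP; apply/derivable1_diffP.
  by apply/funext => u; rewrite /= !fctE /GRing.scale /= mulrC.
have dbm := comp_m _ db; have db'm := comp_m _ db'; have dV'm := comp_m _ dV'.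
(* The group increment along the edge; at 0 only its constant momentum part remains. *)
pose e := cst (h * p / gamma)
  - ((1 + gamma * kappa) / gamma) *: ((beta \o m) * d).
have e0 : e 0 = h * p / gamma by rewrite /e !fctE /= d0 mulr0 scaler0 subr0.
have de : is_diff 0 e (fun u => - ((1 + gamma * kappa) / gamma * (beta 0 * d u))).
  apply: (@is_diff_eq _ _ _ _ _ _ _ (is_diffB (is_diff_cst _ _)
    (is_diffZ _ (is_diffM dbm dd)))).
  by apply/funext => u; rewrite !fctE /GRing.scale /= m0 d0 mul0r addr0 sub0r.
have -> : (fun u => lagrangian_slope sgn (x0 u) (x1 u)
    (momentum_increment h gamma kappa beta p (x0 u) (x1 u))) =
  h^-1 *: (sgn *: (alpha *: d + (beta \o m) * e)
           + 2^-1 *: ((derive1 beta \o m) * d * e))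
  - (h / 2) *: (derive1 V \o m).
  apply/funext => u; rewrite /lagrangian_slope /momentum_increment /e /d /m.
  rewrite /= !fctE /GRing.scale /= (mulrC (_ + _) (2^-1)).
  by congr (_ * (_ * (_ + _ * _) + _ * (_ * _)) - _); ring.
apply: (@is_diff_eq _ _ _ _ _ _ _ (is_diffB
  (is_diffZ h^-1 (is_diffD
    (is_diffZ sgn (is_diffD (is_diffZ alpha dd) (is_diffM dbm de)))
    (is_diffZ 2^-1 (is_diffM (is_diffM db'm dd) de))))
  (is_diffZ (h / 2) dV'm))).
have dE u : d u = x1 u - x0 u by [].
have mE u : m u = 2^-1 * (x0 u + x1 u) by [].
apply/funext => u; move: dE mE m0 d0 e0; clear => dE mE m0 d0 e0.
(* The product-rule output evaluated at [u], by conversion; the second derivative of [beta] is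
   multiplied by [d 0 = 0]. *)
transitivity (h^-1 * (sgn * (alpha * d u + (beta (m 0)
      * - ((1 + gamma * kappa) / gamma * (beta 0 * d u))
      + e 0 * (derive1 beta 0 * m u)))
    + 2^-1 * (derive1 beta (m 0) * d 0
      * - ((1 + gamma * kappa) / gamma * (beta 0 * d u))
      + e 0 * (derive1 beta (m 0) * d u
               + d 0 * (derive1 (derive1 beta) 0 * m u))))
  - h / 2 * (derive1 (derive1 V) 0 * m u)); first by [].
rewrite m0 d0 e0 dE mE /derive1n /=.
move: (x0 u) (x1 u) (beta 0) (derive1 beta 0) (derive1 (derive1 beta) 0)
  (derive1 (derive1 V) 0) => a b c c' c'' v.
by ring.
Qed.

End slopes.

Lemma is_diff_coords (R : realType) :
  [/\ is_diff (0 : R^o * R^o * R^o) (fun w => w.1.1) (fun w => w.1.1),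
      is_diff (0 : R^o * R^o * R^o) (fun w => w.1.2) (fun w => w.1.2)
    & is_diff (0 : R^o * R^o * R^o) (fun w => w.2) (fun w => w.2)].
Proof.
have d12 : is_diff (0 : R^o * R^o * R^o) fst fst by exact: is_diff_fst.
split; last exact: is_diff_snd.
- have d1 : is_diff (fst (0 : R^o * R^o * R^o)) fst fst by exact: is_diff_fst.
  by have K := is_diff_comp d12 d1; exact: K.
- have d2 : is_diff (fst (0 : R^o * R^o * R^o)) snd snd by exact: is_diff_snd.
  by have K := is_diff_comp d12 d2; exact: K.
Qed.

(** * Linearization of the reduced dynamics *)

Section reduced.
Context {R : realType}.
Variables (h alpha gamma kappa p : R) (beta V : R -> R).
Hypotheses (h0 : h != 0) (beta_smooth : smooth_near0 beta)
  (V_smooth : smooth_near0 V).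

(** The coefficients a and c: one multiplies the second difference; the other collects the two
    midpoints, whence the 4. *)
Let curvature := ((1 + gamma * kappa) * beta 0 ^+ 2 / gamma - alpha) / h.
Let stiffness := - (h * derive1n 2 V 0) / 4.

(** The slope formulas need derivability at both midpoints; these depend continuously on [w] and
    vanish at 0, so they stay in the neighbourhood where [beta] and [V] are smooth. *)
Lemma reduced_equation_slopes :
  \forall w \near (0 : R^o * R^o * R^o),
    (let ds := momentum_increment h gamma kappa beta p in
     lagrangian_slope h alpha beta V (-1) w.1.2 w.2 (ds w.1.2 w.2)
     + lagrangian_slope h alpha beta V 1 w.1.1 w.1.2 (ds w.1.1 w.1.2))
    = reduced_equation_lhs h alpha gamma kappa beta V p w.
Proof.
have mid_near (x0 x1 : R^o * R^o * R^o -> R) :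
    is_diff 0 x0 x0 -> is_diff 0 x1 x1 -> x0 0 = 0 -> x1 0 = 0 ->
    \forall w \near (0 : R^o * R^o * R^o),
      derivable beta ((x0 w + x1 w) / 2) 1 /\ derivable V ((x0 w + x1 w) / 2) 1.
  move=> dx0 dx1 x00 x10; pose m := 2^-1 *: (x0 + x1).
  have dm : is_diff 0 m m by apply: is_diffZ; apply: is_diffD.
  have m0 : m 0 = 0 by rewrite /m /= !fctE x00 x10 addr0 scaler0.
  have mc := differentiable_continuous (@ex_diff _ _ _ _ _ _ _ dm).
  have : \forall x \near m 0, derivable beta x 1 /\ derivable V x 1.
    rewrite m0; apply: filterS2 beta_smooth V_smooth => x bx vx.
    by split; [exact: (bx 0%N)|exact: (vx 0%N)].
  move=> /mc mP; apply: (@filterS _ (nbhs 0) _ _ _ _ mP) => w /=.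
  by rewrite /m !fctE /GRing.scale /= mulrC.
have [d1 d2 d3] := is_diff_coords R.
apply: filterS2 (mid_near _ _ d2 d3 erefl erefl) (mid_near _ _ d1 d2 erefl erefl).
move=> [[x y] z] /= [b1 v1] [b0 v0].
set ds := momentum_increment h gamma kappa beta p.
rewrite -[RHS]/(phi_equation_lhs _ _ _ _ _ (x, - ds x y) (y, 0) (z, ds y z)).
rewrite [RHS](phi_equation_slopes _ alpha gamma _ _ _ _ _ h0 b0 v0 b1 v1) /=.
by rewrite subr0 sub0r opprK.
Qed.

(* The terms in [beta' 0] of the two slopes cancel, so the linearization depends
   neither on [beta' 0] nor on the momentum level [p]. *)
Lemma is_diff_reduced_equation :
  is_diff (0 : R^o * R^o * R^o)
    (reduced_equation_lhs h alpha gamma kappa beta V p)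
    (fun w => curvature * (w.1.1 - 2 * w.1.2 + w.2)
              + stiffness * (w.1.1 + 2 * w.1.2 + w.2)).
Proof.
have [b1 b2] : derivable beta 0 1 /\ derivable (derive1 beta) 0 1.
  by have H := nbhs_singleton beta_smooth; split; [exact: (H 0%N)|exact: (H 1%N)].
have v2 : derivable (derive1 V) 0 1 by exact: (nbhs_singleton V_smooth 1%N).
have [d1 d2 d3] := is_diff_coords R.
apply: near_eq_is_diff reduced_equation_slopes _.
have D sgn := @is_diff_lagrangian_slope _ h alpha gamma beta V _ kappa p sgn.
apply: (@is_diff_eq _ _ _ _ _ _ _ (is_diffD
  (D _ (-1) _ _ d2 d3 erefl erefl b1 b2 v2)
  (D _ 1 _ _ d1 d2 erefl erefl b1 b2 v2))).
apply/funext => -[[x y] z]; rewrite fctE /curvature /stiffness /derive1n /=.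
move: (beta 0) (derive1 beta 0) (derive1 (derive1 V) 0) => b b' v.
rewrite (_ : 4^-1 = 2^-1 * 2^-1 :> R); last by field.
by ring.
Qed.

Lemma reduced_equation0 : derive1 V 0 = 0 ->
  reduced_equation_lhs h alpha gamma kappa beta V p 0 = 0.
Proof.
move=> V'0; rewrite -(nbhs_singleton reduced_equation_slopes) /=.
(* Both edges carry the same group increment, so their [beta 0] terms have opposite signs and
   cancel. *)
by rewrite /lagrangian_slope /= !addr0 mul0r V'0; ring.
Qed.

End reduced.

(** * Spectrum of the recurrence z = t y - x *)

Section companion.
Context {R : realType}.

(** The imaginary part reads v (2 u - t) = 0. If v = 0, the real part gives (2 u - t)^2 = t^2 - 4 <
    0, which is absurd; so t = 2 u, and the real part becomes u^2 + v^2 = 1. *)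
Lemma root_unit_circle (t : R) (z : R[i]) : `|t| < 2 ->
  z ^+ 2 - t%:C%C * z + 1 = 0 -> `|z| = 1.
Proof.
case: z => u v; rewrite ltr_norml => /andP[t1 t2] root_t.
have [re im] : u * u - v * v - t * u + 1 = 0 /\ u * v + v * u - t * v = 0.
  move: root_t; rewrite expr2; simpc => /eqP; rewrite eq_complex /=.
  by move=> /andP[/eqP re /eqP im].
rewrite normc_def /= (_ : _ + _ = 1) ?sqrtr1//.
have [v0|v0] := eqVneq v 0.
  exfalso; move: re; rewrite v0 => re.
  have : 0 < (2 - t) * (2 + t) by apply: mulr_gt0; lra.
  have := sqr_ge0 (2 * u - t); rewrite expr2; nra.
suff tE : t = 2 * u by nra.
by apply: (mulIf v0); lra.
Qed.

Definition companion (t : R) : 'M[R]_2 :=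
  \matrix_(i < 2, j < 2) (nth [::] [:: [:: 0; -1]; [:: 1; t]] i)`_j.

Lemma row2_companion (t x y : R) :
  row2 x y *m companion t = row2 y (t * y - x).
Proof.
apply/rowP => j; rewrite !mxE !big_ord_recl big_ord0 !mxE /=.
by case: j => [[|[|//]] ?] /=; ring.
Qed.

(** A left eigenvector has the form (a, z a) with a nonzero, and its second coordinate then yields
    z^2 - t z + 1 = 0. *)
Lemma spectrum_companion (t : R) : `|t| < 2 ->
  (spectrum (companion t) `<=` @unit_circle R)%classic.
Proof.
move=> t2 z /eigenvalueP[v vz v0]; apply: (root_unit_circle _ _ t2).
have /rowP/(_ 0) := vz; have /rowP/(_ 1) := vz.
rewrite !mxE !big_ord_recl !big_ord0 !mxE /=.
set a := v 0 0; rewrite (_ : v 0 (lift _ _) = v 0 1); last by congr (v _ _); apply/val_inj.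
set b := v 0 1.
rewrite rmorphN1 rmorph0 rmorph1 => e2 e1.
have eb : b = z * a by rewrite -e1; ring.
have a0 : a != 0.
  apply: contra v0 => /eqP a0; apply/eqP/rowP => j; rewrite mxE.
  case: j => [[|[|//]] ji].
    by rewrite -[RHS]a0; congr (v _ _); apply/val_inj.
  by rewrite (_ : Ordinal ji = 1) -/b ?eb ?a0 ?mulr0//; apply/val_inj.
apply: (mulIf a0); rewrite mul0r.
have : z * b = - a + t%:C%C * b by rewrite -e2; ring.
by rewrite eb => e; rewrite !mulrDl expr2 -mulrA e; ring.
Qed.

Lemma row2_inj (x y y' : R) : row2 x y = row2 x y' -> y = y'.
Proof. by move=> /rowP/(_ 1); rewrite !mxE. Qed.

Lemma spectrally_stable_linear (a c : R) (F : R^o * R^o * R^o -> R^o) :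
  0 < a -> 0 < c -> F 0 = 0 ->
  is_diff 0 F (fun w => a * (w.1.1 - 2 * w.1.2 + w.2)
                        + c * (w.1.1 + 2 * w.1.2 + w.2)) ->
  spectrally_stable_at0 F.
Proof.
move=> a0 c0 F0 [dF dFE]; split=> //.
have ac : 0 < a + c by exact: addr_gt0.
pose t := 2 * (a - c) / (a + c).
(* The bound -2 < t amounts to a > 0, and t < 2 to c > 0. *)
have t2 : `|t| < 2.
  by rewrite ltr_norml /t ltr_pdivlMr // ltr_pdivrMr //; apply/andP; split; lra.
exists (companion t); last exact: spectrum_companion.
split=> // x y z; rewrite dFE row2_companion /=.
have -> : a * (x - 2 * y + z) + c * (x + 2 * y + z)
    = (a + c) * (z - (t * y - x)) by rewrite /t; field; rewrite lt0r_neq0.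
split=> [/eqP|/row2_inj ->]; last by rewrite subrr mulr0.
by rewrite mulf_eq0 gt_eqF //= subr_eq0 => /eqP ->.
Qed.

End companion.

(** * Relative equilibria and the bound on the gain *)

Theorem theorem3 (R : realType) (h alpha gamma kappa : R) (beta V : R -> R)
    (h_gt0 : 0 < h) (alpha_gt0 : 0 < alpha) (gamma_gt0 : 0 < gamma)
    (beta_smooth : smooth_near0 beta) (V_smooth : smooth_near0 V)
    (beta0 : beta 0 != 0) (V'0 : derive1 V 0 = 0) (V''0 : derive1n 2 V 0 < 0)
    (kappa_gt : (alpha * gamma - beta 0 ^+ 2) / (beta 0 ^+ 2 * gamma) < kappa)
    (q : int -> R * R) (q_phi : forall k : int, (q k).1 = 0)
    (q_s : exists c : R, forall k : int, (q (k + 1)).2 - (q k).2 = c) :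
  relative_equilibrium h alpha gamma kappa beta V q
  /\ spectrally_stable h alpha gamma kappa beta V q.
Proof.
have h0 : h != 0 by exact: lt0r_neq0.
have [c qc] := q_s.
have qc' k : (q k).2 - (q (k - 1)).2 = c by rewrite -(qc (k - 1)) subrK.
have momentum k : controlled_momentum h gamma kappa beta (q k) (q (k + 1))
    = gamma * c / h.
  by rewrite /controlled_momentum !q_phi qc subrr mulr0 add0r.
have db : derivable beta 0 1 by exact: (nbhs_singleton beta_smooth 0%N).
have dV : derivable V 0 1 by exact: (nbhs_singleton V_smooth 0%N).
split.
  split=> // k; split.
    (* Both edges have group increment [c], so their slopes cancel. *)
    rewrite (phi_equation_slopes _ _ _ _ _ _ _ _ h0) ?q_phi ?addr0 ?mul0r //.
    by rewrite /lagrangian_slope qc qc' !addr0 mul0r V'0; ring.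
  apply/s_equationP => //; rewrite momentum.
  by rewrite -{2}(subrK 1 k) momentum.
exists (gamma * c / h) => //.
apply: spectrally_stable_linear (is_diff_reduced_equation _ _ _ _ _ _ _ h0
  beta_smooth V_smooth); last exact: reduced_equation0.
(* Cleared of denominators, the bound on [kappa] is alpha gamma < (1 + gamma kappa) beta(0)^2. *)
- apply: divr_gt0 => //; rewrite subr_gt0 ltr_pdivlMr //.
  have b2 : 0 < beta 0 ^+ 2 * gamma by rewrite mulr_gt0 // exprn_even_gt0.
  by move: kappa_gt; rewrite ltr_pdivrMr // => kappa_gt'; lra.
- by apply: divr_gt0; rewrite // oppr_gt0 pmulr_rlt0.
Qed.
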